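(* Let $M,N\ge 1$ be integers. Let $O$ be an object in $M$-dimensional space with $N$ channels, given by a function $f:D\to\mathbb{R}^N$ on a domain $D\subset\mathbb{R}^M$. Let $A\in\mathbb{R}^{M\times M}$ be an invertible matrix (the spatial transformation) and $B\in\mathbb{R}^{N\times N}$ a matrix (the channel transformation). Let $O^*$ be the object obtained from $O$ by the dual-affine transformation with spatial matrix $A$ and channel matrix $B$, i.e. $O^*$ is given by $f^*:A(D)\to\mathbb{R}^N$, $f^*(\vec X)=B\,f(A^{-1}\vec X)$. Fix a SpaceKernel $\prod_i P_S(M_i)^{t_i}$ of order $O_S$ with point set $PS_S$ and a ChannelKernel $\prod_j P_C(N_j)^{t'_j}$ of order $O_C$ with point set $PS_C$, as defined in the context, where $PS_S\cup PS_C=\{1,\dots,L\}$, and put $P=|PS_S|$, $Q=|PS_C|$. Let $\mathrm{Covariant}(M,N,P,Q,O_S,O_C)(O)$ be the associated covariant, and define $$\mathrm{Invariant}(M,N,P,Q,O_S,O_C)(O)=\frac{\mathrm{Covariant}(M,N,P,Q,O_S,O_C)(O)}{\mathrm{Covariant}(M,N,1,0,0,0)(O)^{\,O_S+L-N O_C/2}\cdot \mathrm{Covariant}(M,N,1,N,0,2)(O)^{\,O_C/2}} ,$$ of degree $L$ and order $K=O_S+O_C$. Then, whenever these quantities are defined for $O$ and $O^*$ (integrals finite, denominators nonzero), $\mathrm{Invariant}(M,N,P,Q,O_S,O_C)$ is invariant under the dual-affine transformation: $$\mathrm{Invariant}(M,N,P,Q,O_S,O_C)(O^* )=\mathrm{Invariant}(M,N,P,Q,O_S,O_C)(O),$$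 where both sides use the same kernels.
   Context: An object in $M$-dimensional space with $N$ channels is a function $f:D\to\mathbb{R}^N$, $D\subset\mathbb{R}^M$; the vector $f(X)$ lists the channel values at the point $X$. Primitives. Let $X_1,\dots,X_L\in D$ be variable points. For an $M$-tuple $M_i=(a_1,\dots,a_M)$ of distinct indices in $\{1,\dots,L\}$, the shape primitive is $P_S(M_i)=\det\big[X_{a_1}\,|\,\cdots\,|\,X_{a_M}\big]$, the determinant of the $M\times M$ matrix whose columns are the coordinate vectors of these points. For an $N$-tuple $N_j=(b_1,\dots,b_N)$ of distinct indices in $\{1,\dots,L\}$, the channel primitive is $P_C(N_j)=\det\big[f(X_{b_1})\,|\,\cdots\,|\,f(X_{b_N})\big]$. Kernels. A SpaceKernel is a finite product $\prod_i P_S(M_i)^{t_i}$ with positive integer exponents $t_i$; its order is $O_S=\sum_i t_i$, and its point set $PS_S\subset\{1,\dots,L\}$ is the set of all indices occurring in the tuples $M_i$. A ChannelKernel is a finite product $\prod_j P_C(N_j)^{t'_j}$ with positive integer exponents $t'_j$; its order is $O_C=\sum_j t'_j$, and its point set $PS_C$ is the set of all indices occurring in the tuples $N_j$. Empty products (order $0$) equal $1$. Covariants. With $L=|PS_S\cup PS_C|$, the covariant associated with the chosen kernels is $$\mathrm{Covariant}(M,N,P,Q,O_S,O_C)(O)=\int_{D}\cdots\int_{D}\ \prod_i P_S(M_i)^{t_i}\ \prod_j P_C(N_j)^{t'_j}\ dX_1\cdots dX_L ,$$ where $dX_k$ is the volume element on $\mathbb{R}^M$. For $O^*$ the same formula is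 used with $D$ replaced by $A(D)$ and $f$ by $f^*$. The two special covariants in the normalization factor are $$\mathrm{Covariant}(M,N,1,0,0,0)(O)=\int_D dX$$ (one point, both kernels trivial) and $$\mathrm{Covariant}(M,N,1,N,0,2)(O)=\int_D\cdots\int_D \det\big[f(X_1)\,|\,\cdots\,|\,f(X_N)\big]^2\,dX_1\cdots dX_N$$ ($N$ points, trivial SpaceKernel, ChannelKernel the square of one channel primitive).
   Formalization: The claimed equality fails by a sign if det A<0 with O_S odd or det B<0 with O_C odd; proved instead: equality when (det A)^{O_S}(det B)^{O_C}>0, and in general Invariant(O* )=sgn(det A)^{O_S} sgn(det B)^{O_C} Invariant(O). D is taken to be a Borel set. *)

(* Defs.v *)
From HB Require Import structures.
From mathcomp Require Import all_boot all_order all_algebra.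
From mathcomp Require Import all_classical all_reals all_analysis.

Set Implicit Arguments.
Unset Strict Implicit.
Unset Printing Implicit Defensive.
Import Order.TTheory GRing.Theory Num.Theory.
Import numFieldNormedType.Exports.
Local Open Scope classical_set_scope.
Local Open Scope ring_scope.

Section pushforward_sigma_finite.
Context d1 d2 (T1 : measurableType d1) (T2 : measurableType d2) (R : realType).
Variables (m : {measure set T1 -> \bar R}) (msf : sigma_finite [set: T1] m).
Variables (f : T1 -> T2) (g : T2 -> T1).
Hypotheses (mf : measurable_fun [set: T1] f) (mg : measurable_fun [set: T2] g).
Hypothesis fK : cancel f g.

Let sigma_finite_pushforward : sigma_finite [set: T2] (pushforward m f).
Proof.
have [F FT Ffin] := msf.
exists (fun i => g @^-1` F i); first by rewrite -preimage_bigcup -FT preimage_setT.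
move=> i; have [mF Foo] := Ffin i; split.
  by rewrite -[X in measurable X]setTI; exact: mg.
rewrite /pushforward (_ : f @^-1` _ = F i)//.
by apply/seteqP; split=> x /=; rewrite fK.
Qed.

Let nu := pushforward m f.
Let nuM : {measure set T2 -> \bar R} :=
  measure_function_pushforward__canonical__measure_function_Measure m mf.

HB.instance Definition _ := isMeasure.Build _ _ _ nu
  (measure0 nuM) (measure_ge0 nuM) (@measure_semi_sigma_additive _ _ _ nuM).
HB.instance Definition _ := Measure_isSigmaFinite.Build _ _ _ nu
  sigma_finite_pushforward.

Lemma pushforward_sigma_finite_measure :
  exists m' : {sigma_finite_measure set T2 -> \bar R},
    pushforward m f = m' :> (set T2 -> \bar R).
Proof. by exists nu. Qed.

End pushforward_sigma_finite.

(* The n-fold product measure mu^n on n.-tuple T (with its product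
   sigma-algebra): mu^0 is the unit mass at the empty tuple, and mu^(n+1) is
   the image of mu \x mu^n under (x, t) |-> x :: t. *)
Fixpoint tuple_power d (T : measurableType d) (R : realType)
    (mu : set T -> \bar R) (n : nat) : set (n.-tuple T) -> \bar R :=
  match n with
  | 0 => \d_[tuple]
  | n'.+1 => pushforward (mu \x @tuple_power d T R mu n')%E
                         (fun p : T * n'.-tuple T => [tuple of p.1 :: p.2])
  end.
Arguments tuple_power {d T R} mu n.

(* This is the content of a library instance that canonical inference does not
   find, because an instance for probability measures takes precedence. *)
Lemma sigma_finite_product_measure1 d1 d2 (T1 : measurableType d1)
    (T2 : measurableType d2) (R : realType)
    (m1 : {sigma_finite_measure set T1 -> \bar R})
    (m2 : {sigma_finite_measure set T2 -> \bar R}) :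
  sigma_finite [set: (T1 * T2)%type] (m1 \x m2)%E.
Proof.
have /sigma_finiteP[F [TF ndF Foo]] := sigma_finiteT m1.
have /sigma_finiteP[G [TG ndG Goo]] := sigma_finiteT m2.
exists (fun n => F n `*` G n).
  rewrite -setXTT TF TG predeqE => -[x y]; split.
    move=> [/= [n _ Fnx] [k _ Gky]]; exists (maxn n k) => //; split.
    - by move: x Fnx; exact/subsetPset/ndF/leq_maxl.
    - by move: y Gky; exact/subsetPset/ndG/leq_maxr.
  by move=> [n _ []/= ? ?]; split; exists n.
move=> k; have [? ?] := Foo k; have [? ?] := Goo k.
split; first exact: measurableX.
by rewrite product_measure1E// lte_mul_pinfty// ge0_fin_numE.
Qed.

Section tuple_power_sigma_finite.
Context d (T : measurableType d) (R : realType).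
Variables (mu : {sigma_finite_measure set T -> \bar R}) (n : nat).

Let tuple_power_ex : exists m : {sigma_finite_measure set (n.-tuple T) -> \bar R},
  tuple_power mu n = m :> (set _ -> \bar R).
Proof.
elim: n => [|k [m IH]]; first by exists (\d_([tuple] : 0.-tuple T)).
rewrite /= IH.
pose f (p : T * k.-tuple T) : k.+1.-tuple T := [tuple of p.1 :: p.2].
pose g (t : k.+1.-tuple T) := (thead t, [tuple of behead t] : k.-tuple T).
have mf : measurable_fun setT f by exact: measurable_cons.
have mg : measurable_fun setT g.
  apply: measurable_fun_pair; last exact: measurable_behead.
  exact: measurable_tnth.
have fK : cancel f g by case=> x t; congr pair; exact: val_inj.
exact: (pushforward_sigma_finite_measure
  (@sigma_finite_product_measure1 _ _ _ _ _ mu m) mf mg fK).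
Qed.

Let tuple_power0 : tuple_power mu n set0 = 0%E.
Proof. by have [m ->] := tuple_power_ex; exact: measure0. Qed.

Let tuple_power_ge0 A : (0 <= tuple_power mu n A)%E.
Proof. by have [m ->] := tuple_power_ex; exact: measure_ge0. Qed.

Let tuple_power_sigma_additive : semi_sigma_additive (tuple_power mu n).
Proof. by have [m ->] := tuple_power_ex; exact: measure_semi_sigma_additive. Qed.

HB.instance Definition _ := isMeasure.Build _ _ _ (tuple_power mu n)
  tuple_power0 tuple_power_ge0 tuple_power_sigma_additive.

Let tuple_power_sigma_finiteT : sigma_finite setT (tuple_power mu n).
Proof. by have [m ->] := tuple_power_ex; exact: sigma_finiteT. Qed.

HB.instance Definition _ := Measure_isSigmaFinite.Build _ _ _ (tuple_power mu n)
  tuple_power_sigma_finiteT.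

End tuple_power_sigma_finite.

Definition measure_col_display : measure_display.
Proof. exact: default_measure_display. Qed.

(* R^m as the type of column vectors, with the sigma-algebra generated by the
   coordinates, that is, the Borel sets. *)
Section measurable_col.
Context (R : realType) (m : nat).

Let coor (i : 'I_m) (X : 'cV[R]_m) : measurableTypeR R := X i ord0.

Let col_set0 : g_sigma_preimage coor set0.
Proof. exact: sigma_algebra0. Qed.

Let col_setC A : g_sigma_preimage coor A -> g_sigma_preimage coor (~` A).
Proof. exact: sigma_algebraC. Qed.

Let col_bigcup (F : (set 'cV[R]_m)^nat) :
  (forall i, g_sigma_preimage coor (F i)) ->
  g_sigma_preimage coor (\bigcup_i (F i)).
Proof. exact: sigma_algebra_bigcup. Qed.

HB.instance Definition _ := @isMeasurable.Build measure_col_display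
  'cV[R]_m (g_sigma_preimage coor) col_set0 col_setC col_bigcup.

Definition col_of_tuple (t : m.-tuple (measurableTypeR R)) : 'cV[R]_m :=
  \col_i tnth t i.

Definition tuple_of_col (X : 'cV[R]_m) : m.-tuple (measurableTypeR R) :=
  [tuple X i ord0 | i < m].

Lemma col_of_tupleK : cancel col_of_tuple tuple_of_col.
Proof.
by move=> t; apply: eq_from_tnth => i; rewrite tnth_map tnth_ord_tuple mxE.
Qed.

Lemma measurable_col_of_tuple : measurable_fun [set: m.-tuple _] col_of_tuple.
Proof.
have E : g_sigma_preimage (fun i => @tnth m (measurableTypeR R) ^~ i) =
    preimage_set_system setT col_of_tuple (g_sigma_preimage coor).
  rewrite -g_sigma_preimage_comp; congr g_sigma_preimage.
  by apply/funext => i; apply/funext => t; rewrite /= /coor mxE.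
move=> _ Y mY; rewrite setTI; rewrite /measurable /= E.
by exists Y => //; rewrite setTI.
Qed.

Lemma measurable_tuple_of_col : measurable_fun [set: 'cV[R]_m] tuple_of_col.
Proof.
apply/measurable_fun_tnthP => i _ Y mY; rewrite setTI.
suff : g_sigma_preimage coor (coor i @^-1` Y).
  suff -> : tnth (T:=measurableTypeR R) ^~ i \o tuple_of_col = coor i by [].
  by apply/funext => X; rewrite /= tnth_map tnth_ord_tuple.
apply: sub_sigma_algebra => /=.
rewrite -bigcup_seq/=; exists i => /=; first by rewrite mem_index_enum.
by exists Y => //; rewrite setTI.
Qed.

End measurable_col.

(* Lebesgue measure on R^m: the m-fold product of Lebesgue measure on R. *)
Definition lebesgue_col (R : realType) (m : nat) : set 'cV[R]_m -> \bar R :=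
  pushforward (tuple_power (@lebesgue_measure R) m) (@col_of_tuple R m).
Arguments lebesgue_col {R m}.

Section lebesgue_col_sigma_finite.
Context (R : realType) (m : nat).

Let lebesgue_col_ex : exists mu : {sigma_finite_measure set 'cV[R]_m -> \bar R},
  lebesgue_col = mu :> (set _ -> \bar R).
Proof.
exact: (pushforward_sigma_finite_measure (sigma_finiteT _)
  (@measurable_col_of_tuple R m) (@measurable_tuple_of_col R m)
  (@col_of_tupleK R m)).
Qed.

Let lebesgue_col0 : @lebesgue_col R m set0 = 0%E.
Proof. by have [mu ->] := lebesgue_col_ex; exact: measure0. Qed.

Let lebesgue_col_ge0 A : (0 <= @lebesgue_col R m A)%E.
Proof. by have [mu ->] := lebesgue_col_ex; exact: measure_ge0. Qed.

Let lebesgue_col_sigma_additive : semi_sigma_additive (@lebesgue_col R m).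
Proof.
by have [mu ->] := lebesgue_col_ex; exact: measure_semi_sigma_additive.
Qed.

HB.instance Definition _ := isMeasure.Build _ _ _ (@lebesgue_col R m)
  lebesgue_col0 lebesgue_col_ge0 lebesgue_col_sigma_additive.

Let lebesgue_col_sigma_finiteT : sigma_finite setT (@lebesgue_col R m).
Proof. by have [mu ->] := lebesgue_col_ex; exact: sigma_finiteT. Qed.

HB.instance Definition _ := Measure_isSigmaFinite.Build _ _ _
  (@lebesgue_col R m) lebesgue_col_sigma_finiteT.

End lebesgue_col_sigma_finite.

(* An object: a channel function on the domain [dom].  The values of [chan]
   outside [dom] are never used. *)
Record object (R : realType) (M N : nat) := Object {
  dom : set 'cV[R]_M;
  chan : 'cV[R]_M -> 'cV[R]_N }.

Definition dual_affine (R : realType) (M N : nat) (A : 'M[R]_M) (B : 'M[R]_N)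
    (O : object R M N) : object R M N :=
  Object [set A *m X | X in dom O] (fun X => B *m chan O (invmx A *m X)).

(* The product of the t-th powers of the primitives of the tuples a, for (a, t)
   in the list; it is a SpaceKernel for n = M and a ChannelKernel for n = N.
   Points are numbered from 0. *)
Definition moment_kernel (n L : nat) := seq (n.-tuple 'I_L * nat).

Section moment_kernel.
Context (n L : nat).
Implicit Types (k : moment_kernel n L).

Definition is_moment_kernel k : bool :=
  all (fun p : n.-tuple 'I_L * nat => uniq p.1 && (0 < p.2)%N) k.

Definition kernel_order k : nat := (\sum_(p <- k) p.2)%N.

Definition point_set k : {set 'I_L} :=
  [set i : 'I_L | has (fun p : n.-tuple 'I_L * nat => i \in p.1) k]%SET.

Definition primitive (R : realType) (V : 'I_L -> 'cV[R]_n)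
    (a : n.-tuple 'I_L) : R :=
  \det (\matrix_(i < n, j < n) V (tnth a j) i ord0).

Definition eval_kernel (R : realType) k (V : 'I_L -> 'cV[R]_n) : R :=
  \prod_(p <- k) primitive V p.1 ^+ p.2.

End moment_kernel.

(* D x ... x D, with L factors *)
Definition domain_power (R : realType) (M N : nat) (O : object R M N) (L : nat) :
    set (L.-tuple 'cV[R]_M) :=
  [set X | forall i, dom O (tnth X i)].
Arguments domain_power {R M N} O L.

Section covariant.
Context (R : realType) (M N : nat).
Implicit Types (O : object R M N).

Definition covariant_integrand O (L : nat) (kS : moment_kernel M L)
    (kC : moment_kernel N L) (X : L.-tuple 'cV[R]_M) : R :=
  eval_kernel kS (tnth X) * eval_kernel kC (fun i => chan O (tnth X i)).

Definition covariant O (L : nat) (kS : moment_kernel M L)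
    (kC : moment_kernel N L) : R :=
  \int[tuple_power lebesgue_col L]_(X in domain_power O L)
    covariant_integrand O kS kC X.

Definition covariant_finite O (L : nat) (kS : moment_kernel M L)
    (kC : moment_kernel N L) : Prop :=
  (tuple_power lebesgue_col L).-integrable (domain_power O L)
    (fun X => (covariant_integrand O kS kC X)%:E).

(* Covariant(M,N,1,N,0,2): the square of one primitive on all of N points. *)
Definition square_kernel : moment_kernel N N := [:: (ord_tuple N, 2%N)].

Definition volume O : R := @covariant O 1 [::] [::].
Definition square_covariant O : R := @covariant O N [::] square_kernel.

(* The exponents may be negative or half-integral, whence real powers: [powR]
   is the usual x^r for x > 0, and 0^r is 1 for r = 0 and 0 otherwise. *)
Definition normalization O (L : nat) (kS : moment_kernel M L)
    (kC : moment_kernel N L) : R :=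
  volume O `^ ((kernel_order kS + L)%:R - (N * kernel_order kC)%:R / 2) *
  square_covariant O `^ ((kernel_order kC)%:R / 2).

Definition moment_invariant O (L : nat) (kS : moment_kernel M L)
    (kC : moment_kernel N L) : R :=
  covariant O kS kC / normalization O kS kC.

Definition moment_invariant_defined O (L : nat) (kS : moment_kernel M L)
    (kC : moment_kernel N L) : Prop :=
  [/\ covariant_finite O kS kC,
      @covariant_finite O 1 [::] [::],
      @covariant_finite O N [::] square_kernel &
      normalization O kS kC != 0].

End covariant.

(* Main.v *)
Require Import Defs.
From mathcomp Require Import all_boot all_order all_algebra.
From mathcomp Require Import all_classical all_reals all_analysis.
From mathcomp Require Import measurable_realfun ring.

Set Implicit Arguments.
Unset Strict Implicit.
Unset Printing Implicit Defensive.
Import Order.TTheory GRing.Theory Num.Theory.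
Local Open Scope classical_set_scope.
Local Open Scope ring_scope.

(* Substituting A X_k for every point multiplies the SpaceKernel by
   det(A)^(O_S) and the ChannelKernel by det(B)^(O_C), and the volume elements
   contribute |det A|^L; the three covariants in the quotient then scale by
   powers of the determinants that cancel up to signs.
   The linear change of variables for nonnegative measurable functions on R^M
   goes by induction on M: an invertible matrix is a product of block triangular
   ones, each of which acts, by Fubini-Tonelli, as a one-dimensional affine map
   or a translation on the fibres over a map of smaller dimension. *)

(** * Maps that multiply integrals by a constant, and their calculus *)

Section scales_integral.
Local Open Scope ereal_scope.

Definition scales_integral d (T : measurableType d) (R : realType)
    (mu : set T -> \bar R) (phi : T -> T) (c : R) : Prop :=
  measurable_fun setT phi /\
  forall f : T -> \bar R, measurable_fun setT f -> (forall x, 0 <= f x) ->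
    \int[mu]_x f (phi x) = c%:E * \int[mu]_x f x.

Lemma scales_integral_id d (T : measurableType d) (R : realType)
    (mu : set T -> \bar R) : scales_integral mu id 1.
Proof. by split => // f _ _; rewrite mul1e. Qed.

Lemma scales_integral_comp d (T : measurableType d) (R : realType)
    (mu : set T -> \bar R) (phi psi : T -> T) (c e : R) :
  scales_integral mu phi c -> scales_integral mu psi e ->
  scales_integral mu (phi \o psi) (c * e)%R.
Proof.
move=> [mphi Hphi] [mpsi Hpsi]; split; first exact: measurableT_comp.
move=> f mf f0; rewrite (Hpsi (fun x => f (phi x)))//; last first.
  exact: (measurableT_comp mf mphi).
by rewrite Hphi// muleA -EFinM mulrC.
Qed.

Section skew_product.
Context d1 d2 (T1 : measurableType d1) (T2 : measurableType d2) (R : realType).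
Variables (m1 : {sigma_finite_measure set T1 -> \bar R}).
Variables (m2 : {sigma_finite_measure set T2 -> \bar R}).

(** By Tonelli with the second coordinate integrated first: every fibre map [psi x] contributes the
    same [e], which leaves the outer integral, and [phi] then contributes [c]. *)
Lemma scales_integral_skew_snd (phi : T1 -> T1) (psi : T1 -> T2 -> T2)
    (c e : R) : (0 <= e)%R ->
  scales_integral m1 phi c -> (forall x, scales_integral m2 (psi x) e) ->
  measurable_fun setT (fun p : T1 * T2 => psi p.1 p.2) ->
  scales_integral (m1 \x m2) (fun p => (phi p.1, psi p.1 p.2)) (c * e)%R.
Proof.
move=> e0 [mphi Hphi] Hpsi mpsi.
have mPhi : measurable_fun setT (fun p : T1 * T2 => (phi p.1, psi p.1 p.2)).
  by apply: measurable_fun_pair => //; exact: measurableT_comp.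
split=> // f mf f0.
rewrite (fubini_tonelli1 (fun p => f (phi p.1, psi p.1 p.2)))//; last first.
  exact: (measurableT_comp mf mPhi).
rewrite /fubini_F /=.
have mF : measurable_fun setT (fun x => \int[m2]_y f (x, y)).
  exact: (measurable_fun_fubini_tonelli_F f).
transitivity (\int[m1]_x (e%:E * \int[m2]_y f (phi x, y))).
  apply: eq_integral => x _; rewrite ((Hpsi x).2 (fun y => f (phi x, y)))//.
  by apply: measurableT_comp => //; exact: measurable_pair1.
rewrite ge0_integralZl//; last first.
- by move=> x _; exact: integral_ge0.
- exact: (measurableT_comp mF mphi).
rewrite (Hphi (fun x => \int[m2]_y f (x, y)))//; last first.
  by move=> x; exact: integral_ge0.
by rewrite fubini_tonelli1// muleA -EFinM mulrC.
Qed.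

(** Tonelli in the other order, for maps whose first coordinate is altered depending on the
    second. *)
Lemma scales_integral_skew_fst (phi : T2 -> T1 -> T1) (psi : T2 -> T2)
    (c e : R) : (0 <= c)%R ->
  (forall y, scales_integral m1 (phi y) c) -> scales_integral m2 psi e ->
  measurable_fun setT (fun p : T1 * T2 => phi p.2 p.1) ->
  scales_integral (m1 \x m2) (fun p => (phi p.2 p.1, psi p.2)) (c * e)%R.
Proof.
move=> c0 Hphi [mpsi Hpsi] mphi.
have mPhi : measurable_fun setT (fun p : T1 * T2 => (phi p.2 p.1, psi p.2)).
  by apply: measurable_fun_pair => //; exact: measurableT_comp.
split=> // f mf f0.
rewrite (fubini_tonelli2 (fun p => f (phi p.2 p.1, psi p.2)))//; last first.
  exact: (measurableT_comp mf mPhi).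
rewrite /fubini_G /=.
have mG : measurable_fun setT (fun y => \int[m1]_x f (x, y)).
  exact: (measurable_fun_fubini_tonelli_G f).
transitivity (\int[m2]_y (c%:E * \int[m1]_x f (x, psi y))).
  apply: eq_integral => y _; rewrite ((Hphi y).2 (fun x => f (x, psi y)))//.
  by apply: measurableT_comp => //; exact: measurable_pair2.
rewrite ge0_integralZl//; last first.
- by move=> x _; exact: integral_ge0.
- exact: (measurableT_comp mG mpsi).
rewrite (Hpsi (fun y => \int[m1]_x f (x, y)))//; last first.
  by move=> x; exact: integral_ge0.
by rewrite fubini_tonelli2// muleA -EFinM.
Qed.

End skew_product.

(** [m2] is the image of [m1] under [theta], expressed by integrals. As [theta] intertwines [phi]
    and [psi], integrals of [f \o psi] pull back to integrals of [f \o theta \o phi]. *)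
Lemma scales_integral_transfer d1 d2 (T1 : measurableType d1)
    (T2 : measurableType d2) (R : realType) (m1 : set T1 -> \bar R)
    (m2 : set T2 -> \bar R) (theta : T1 -> T2) (phi : T1 -> T1)
    (psi : T2 -> T2) (c : R) :
  measurable_fun setT theta ->
  (forall f : T2 -> \bar R, measurable_fun setT f -> (forall y, 0 <= f y) ->
    \int[m2]_y f y = \int[m1]_x f (theta x)) ->
  theta \o phi =1 psi \o theta -> measurable_fun setT psi ->
  scales_integral m1 phi c -> scales_integral m2 psi c.
Proof.
move=> mtheta m12 thetaE mpsi [mphi Hphi]; split=> // f mf f0.
rewrite (m12 (fun y => f (psi y)))//; last exact: (measurableT_comp mf mpsi).
rewrite m12// -(Hphi (fun x => f (theta x)))//; last first.
  exact: (measurableT_comp mf mtheta).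
by congr integral; apply/funext => x; rewrite -[psi _]thetaE.
Qed.

Lemma scales_integral_Rintegral d (T : measurableType d) (R : realType)
    (mu : {measure set T -> \bar R}) (phi : T -> T) (c : R) (D : set T)
    (f : T -> R) :
  scales_integral mu phi c -> measurable D -> mu.-integrable D (EFin \o f) ->
  (\int[mu]_(x in phi @^-1` D) f (phi x) = c * \int[mu]_(x in D) f x)%R.
Proof.
move=> [mphi Hphi] mD intf.
have mf : measurable_fun D (EFin \o f) by exact: (measurable_int mu).
(* A nonnegative [g] is extended by zero outside [D]; the positive and negative parts of [f] are
   then treated separately. *)
have key (g : T -> \bar R) : measurable_fun D g -> (forall x, 0 <= g x) ->
    \int[mu]_(x in phi @^-1` D) g (phi x) = c%:E * \int[mu]_(x in D) g x.
  move=> mg g0; rewrite [in RHS]integral_mkcond -Hphi//; last 2 first.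
  - exact/(measurable_restrictT _ mD).
  - by move=> x; rewrite erestrict_ge0.
  by rewrite integral_mkcond; apply: eq_integral => x _; rewrite !patchE.
rewrite /Rintegral -[c in RHS]/(fine c%:E) -fineM//; last first.
  exact: integrable_fin_num.
(* Distributing [c] over the difference must avoid infinity minus infinity; the positive part has a
   finite integral. *)
congr fine; rewrite integralE [in RHS]integralE muleBr//; last first.
  by apply: fin_num_adde_defr; apply: integrable_pos_fin_num.
congr (_ - _).
- rewrite -key//; first by apply: eq_integral => x _; rewrite !funeposE.
  exact: measurable_funepos.
- rewrite -key//; first by apply: eq_integral => x _; rewrite !funenegE.
  exact: measurable_funeneg.
Qed.

(** The image of [mu] under [phi] and the multiple of [mu] by [c] are measures that agree on
    measurable sets, so they have the same integrals. *)
Lemma scales_integral_preimage d (T : measurableType d) (R : realType)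
    (mu : {measure set T -> \bar R}) (phi : T -> T) (c : R) :
  measurable_fun setT phi -> (0 < c)%R ->
  (forall A, measurable A -> mu (phi @^-1` A) = c%:E * mu A) ->
  scales_integral mu phi c.
Proof.
move=> mphi c0 muphi; split=> // f mf f0.
pose k := NngNum (ltW c0).
rewrite -[RHS](ge0_integral_mscale mu measurableT k)//.
transitivity (\int[pushforward mu phi]_y f y).
  by rewrite (ge0_integral_pushforward mphi)// preimage_setT.
pose m1 := measure_function_pushforward__canonical__measure_function_Measure
  mu mphi.
apply: (@eq_measure_integral _ _ _ _ (mscale k mu) m1) => A mA _.
exact: muphi.
Qed.

End scales_integral.

Lemma integral_tuple_powerS d (T : measurableType d) (R : realType)
    (mu : {sigma_finite_measure set T -> \bar R}) (n : nat)
    (f : n.+1.-tuple T -> \bar R) :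
  measurable_fun setT f -> (forall X, 0 <= f X)%E ->
  (\int[tuple_power mu n.+1]_X f X =
   \int[mu \x tuple_power mu n]_p f [tuple of p.1 :: p.2])%E.
Proof.
move=> mf f0; rewrite /tuple_power -/tuple_power.
have mcons : measurable_fun setT
    (fun p : T * n.-tuple T => [tuple of p.1 :: p.2]).
  exact: measurable_cons.
by rewrite (ge0_integral_pushforward mcons)// preimage_setT.
Qed.

(** * Affine changes of variable on the line *)

Section lebesgue_affine.
Context (R : realType).

Lemma scales_lebesgue_affine (a b : R) : a != 0 ->
  scales_integral (@lebesgue_measure R)
    (fun x : measurableTypeR R => a * x + b) `|a|^-1.
Proof.
move=> a0.
pose phi (x : measurableTypeR R) : measurableTypeR R := a * x + b.
rewrite -/phi.
have an0 : 0 < `|a| by rewrite normr_gt0.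
have mphi : measurable_fun setT phi.
  by apply: measurable_funD => //; exact: measurable_funM.
apply: scales_integral_preimage => //; first by rewrite invr_gt0.
pose k := NngNum (ltW an0).
pose m1 := measure_function_pushforward__canonical__measure_function_Measure
  (@lebesgue_measure R) mphi.
move=> A mA.
(* In this form the right-hand side is a measure in [A], and uniqueness of Lebesgue measure leaves
   only half-open intervals to check. *)
suff E : lebesgue_measure A = (`|a|%:E * lebesgue_measure (phi @^-1` A))%E.
  by rewrite /= [X in (_ * X)%E]E muleA -EFinM mulVf ?mul1e// gt_eqF.
apply: (@lebesgue_measure_unique _ (mscale k m1)) mA.
move=> _ [[x y] _ <-]; rewrite /= /mscale /= /pushforward.
rewrite lebesgue_measure_itv/=.
have [a_gt0|a_lt0] := ltrP 0 a.
  have -> : phi @^-1` `]x, y] = `](x - b) / a, (y - b) / a]%classic.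
    apply/seteqP; split=> z; rewrite /phi /= !in_itv/= ltr_pdivrMr//
      ler_pdivlMr// ltrBlDr lerBrDr (mulrC z); exact.
  rewrite lebesgue_measure_itv/= !lte_fin ltr_pM2r ?invr_gt0// ltrD2r.
  case: ifP => _; last by rewrite mule0.
  by rewrite -!EFinB -EFinM gtr0_norm//; congr EFin; field; exact/lt0r_neq0.
have {}a_lt0 : a < 0 by rewrite lt_neqAle a0.
(* A negative slope exchanges the endpoints, so the preimage is closed on the left instead; its
   length is not affected. *)
have -> : phi @^-1` `]x, y] = `[(y - b) / a, (x - b) / a[%classic.
  apply/seteqP; split=> z; rewrite /phi /= !in_itv/= ltr_ndivlMr//
      ler_ndivrMr// ltrBlDr lerBrDr (mulrC z) andbC; exact.
rewrite lebesgue_measure_itv/= !lte_fin ltr_nM2r ?invr_lt0// ltrD2r.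
case: ifP => _; last by rewrite mule0.
by rewrite -!EFinB -EFinM ltr0_norm//; congr EFin; field.
Qed.

End lebesgue_affine.

(** * Measurability and splitting off one coordinate in the space of columns *)

Section lebesgue_col.
Context (R : realType).

Lemma measurable_coord (n : nat) (i : 'I_n) :
  measurable_fun setT (fun X : 'cV[R]_n => X i ord0 : measurableTypeR R).
Proof.
rewrite (_ : (fun X => _) =
    (tnth (T := measurableTypeR R) ^~ i) \o @tuple_of_col R n).
  apply: measurableT_comp; [exact: measurable_tnth|].
  exact: measurable_tuple_of_col.
by apply/funext => X; rewrite /= tnth_map tnth_ord_tuple.
Qed.

Lemma measurable_fun_col d (T : measurableType d) (n : nat)
    (f : T -> 'cV[R]_n) :
  (forall i, measurable_fun setT (fun x => f x i ord0 : measurableTypeR R)) ->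
  measurable_fun setT f.
Proof.
move=> mf.
rewrite (_ : f = @col_of_tuple R n \o (@tuple_of_col R n \o f)).
  apply: measurableT_comp; first exact: measurable_col_of_tuple.
  apply/measurable_fun_tnthP => i.
  rewrite (_ : _ \o _ = fun x => f x i ord0)//.
  by apply/funext => x; rewrite /= tnth_map tnth_ord_tuple.
apply/funext => x; apply/colP => i.
by rewrite /= mxE tnth_map tnth_ord_tuple.
Qed.

Lemma measurable_mulmx (m n : nat) (A : 'M[R]_(m, n)) :
  measurable_fun setT (fun X : 'cV[R]_n => A *m X : 'cV[R]_m).
Proof.
apply: measurable_fun_col => i.
rewrite (_ : (fun X => _) =
    fun X : 'cV[R]_n => \sum_(j < n) A i j * X j ord0).
  apply: measurable_sum => j; apply: measurable_funM => //.
  exact: measurable_coord.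
by apply/funext => X; rewrite mxE.
Qed.

Lemma measurable_fun_col_add d (T : measurableType d) (n : nat)
    (f g : T -> 'cV[R]_n) :
  measurable_fun setT f -> measurable_fun setT g ->
  measurable_fun setT (fun x => f x + g x).
Proof.
move=> mf mg; apply: measurable_fun_col => i.
rewrite (_ : (fun X => _) = (fun x => f x i ord0) \+ (fun x => g x i ord0)).
  apply: measurable_funD.
  - exact: (measurableT_comp (measurable_coord i) mf).
  - exact: (measurableT_comp (measurable_coord i) mg).
by apply/funext => X; rewrite /= mxE.
Qed.

(** The block form, with [1 + n] convertible to [n.+1], lets block matrices act by the block product
    formulas. *)
Definition col_cons (n : nat) (p : measurableTypeR R * 'cV[R]_n) :
  'cV[R]_n.+1 := col_mx (p.1%:M : 'M[R]_1) p.2.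

Lemma measurable_col_cons (n : nat) : measurable_fun setT (@col_cons n).
Proof.
apply: measurable_fun_col => i; rewrite /col_cons.
rewrite -[i](@splitK 1 n); case: (fintype.split _) => j /=.
  under eq_fun do rewrite (@col_mxEu _ 1) ord1 mxE eqxx mulr1n.
  exact: measurable_fst.
under eq_fun do rewrite (@col_mxEd _ 1).
exact: (measurableT_comp (measurable_coord j)).
Qed.

(** Lebesgue measure on columns is an image of a measure on tuples, where one factor splits off by
    definition. Both sides become iterated integrals over a real and a tuple. *)
Lemma integral_lebesgue_colS (n : nat) (f : 'cV[R]_n.+1 -> \bar R) :
  measurable_fun setT f -> (forall X, 0 <= f X)%E ->
  (\int[lebesgue_col]_X f X =
   \int[(@lebesgue_measure R) \x (@lebesgue_col R n)]_p f (col_cons p))%E.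
Proof.
move=> mf f0.
have mcol k := @measurable_col_of_tuple R k.
have mfk : measurable_fun setT (f \o @col_of_tuple R n.+1).
  exact: (measurableT_comp mf (mcol n.+1)).
rewrite [in LHS]/lebesgue_col (ge0_integral_pushforward (mcol _))//.
rewrite preimage_setT.
rewrite (@integral_tuple_powerS _ _ _ lebesgue_measure n
  (f \o @col_of_tuple R n.+1))//; last by move=> X; exact: f0.
have mfc := measurableT_comp mf (@measurable_col_cons n).
rewrite (fubini_tonelli1 (fun p => f (col_cons p)))//.
have mft : measurable_fun setT (fun p : measurableTypeR R * n.-tuple _ =>
    (f \o @col_of_tuple R n.+1) [tuple of p.1 :: p.2]).
  by apply: (measurableT_comp mfk); exact: measurable_cons.
rewrite (fubini_tonelli1 (fun p : measurableTypeR R * n.-tuple _ =>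
  (f \o @col_of_tuple R n.+1) [tuple of p.1 :: p.2]))//; last first.
  by move=> X; exact: f0.
apply: eq_integral => x _; rewrite /fubini_F/=.
rewrite (ge0_integral_pushforward (mcol n))//; last first.
  exact: (measurableT_comp mfc (measurable_pair1 x)).
rewrite preimage_setT; apply: eq_integral => t _ /=; congr f.
apply/colP => i; rewrite /col_cons mxE -[i](@splitK 1 n).
case: (fintype.split _) => j /=.
  by rewrite (@col_mxEu _ 1) ord1 mxE eqxx mulr1n.
rewrite (@col_mxEd _ 1) mxE (_ : @rshift 1 n j = lift ord0 j) ?tnthS//.
exact: val_inj.
Qed.

End lebesgue_col.

(** * Linear change of variables in every dimension *)

Section lebesgue_linear.
Context (R : realType).
Local Notation lambda n := (@lebesgue_col R n).

Lemma scales_lebesgue_col0 (phi : 'cV[R]_0 -> 'cV[R]_0) :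
  scales_integral (lambda 0) phi 1.
Proof.
rewrite (_ : phi = id); first exact: scales_integral_id.
by apply/funext => X; rewrite [LHS]flatmx0 [RHS]flatmx0.
Qed.

Lemma measurable_col_translation (n : nat) (C : 'cV[R]_n) :
  measurable_fun setT (fun X : 'cV[R]_n => X + C).
Proof. exact: measurable_fun_col_add. Qed.

Lemma scales_lebesgue_colS (n : nat)
    (phi : measurableTypeR R * 'cV[R]_n -> measurableTypeR R * 'cV[R]_n)
    (psi : 'cV[R]_n.+1 -> 'cV[R]_n.+1) (c : R) :
  @col_cons R n \o phi =1 psi \o @col_cons R n -> measurable_fun setT psi ->
  scales_integral ((@lebesgue_measure R) \x (lambda n))%E phi c ->
  scales_integral (lambda n.+1) psi c.
Proof.
exact: (scales_integral_transfer (measurable_col_cons (n := n))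
  (@integral_lebesgue_colS R n)).
Qed.

Lemma scales_lebesgue_col_translation (n : nat) (C : 'cV[R]_n) :
  scales_integral (lambda n) (fun X => X + C) 1.
Proof.
elim: n C => [|n IH] C; first exact: scales_lebesgue_col0.
pose D : 'cV[R]_n := @dsubmx _ 1 n 1 C.
pose c := C ord0 ord0.
have CE : C = col_cons (c, D).
  rewrite /col_cons -[LHS](@vsubmxK _ 1 n) [usubmx _]mx11_scalar !mxE.
  by rewrite /c /D /=; congr (@col_mx _ 1 n 1 (C _ _)%:M _); exact: val_inj.
(* The first coordinate moves by an affine map of slope 1, the others by the induction
   hypothesis. *)
apply: (@scales_lebesgue_colS n (fun p => (1 * p.1 + c, p.2 + D))).
- by move=> p /=; rewrite mul1r CE /col_cons/= (@add_col_mx _ 1) raddfD.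
- exact: measurable_col_translation.
have := @scales_integral_skew_snd _ _ _ _ _ lebesgue_measure (lambda n)
  (fun x : measurableTypeR R => 1 * x + c) (fun _ Y => Y + D) 1 1 ler01.
rewrite mulr1; apply.
- by rewrite -[X in scales_integral _ _ X]invr1 -{2}normr1;
  exact/scales_lebesgue_affine/oner_neq0.
- by move=> _; exact: IH.
- exact: (measurableT_comp (measurable_col_translation D) measurable_snd).
Qed.

Lemma measurable_scalar_col1 :
  measurable_fun setT (fun x : measurableTypeR R => x%:M : 'cV[R]_1).
Proof.
apply: measurable_fun_col => i.
rewrite (_ : (fun x => _) = id); first exact: measurable_id.
by apply/funext => x; rewrite ord1 mxE eqxx mulr1n.
Qed.

(** With the first coordinate [x] fixed, the shear translates the remaining ones by [x] times
    [w]. *)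
Lemma scales_lebesgue_col_lower (n : nat) (w : 'cV[R]_n) :
  scales_integral (lambda n.+1)
    (mulmx (block_mx (1%:M : 'M[R]_1) 0 w 1%:M : 'M[R]_(1 + n))) 1.
Proof.
apply: (@scales_lebesgue_colS n
  (fun p => (p.1, p.2 + w *m (p.1%:M : 'M[R]_1)))).
- move=> p; rewrite /col_cons /= (@mul_block_col _ 1 n 1 n).
  by rewrite !mul1mx mul0mx addr0 addrC.
- exact: measurable_mulmx.
have := @scales_integral_skew_snd _ _ _ _ _ lebesgue_measure (lambda n)
  id (fun x Y => Y + w *m (x%:M : 'M[R]_1)) 1 1 ler01.
rewrite mulr1; apply.
- exact: scales_integral_id.
- by move=> x; exact: scales_lebesgue_col_translation.
- apply: measurable_fun_col_add; first exact: measurable_snd.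
  apply: (measurableT_comp (measurable_mulmx w)).
  exact: (measurableT_comp measurable_scalar_col1 measurable_fst).
Qed.

(** With the last coordinates [Y] fixed, the first one undergoes an affine map of slope [a]; only
    its constant term depends on [Y]. *)
Lemma scales_lebesgue_col_upper (n : nat) (a : R) (v : 'rV[R]_n)
    (S : 'M[R]_n) (c : R) : a != 0 ->
  scales_integral (lambda n) (mulmx S) c ->
  scales_integral (lambda n.+1)
    (mulmx (block_mx (a%:M : 'M[R]_1) v 0 S : 'M[R]_(1 + n))) (`|a|^-1 * c).
Proof.
move=> a0 HS.
apply: (@scales_lebesgue_colS n
  (fun p => (a * p.1 + (v *m p.2) ord0 ord0, S *m p.2))).
- move=> p; rewrite /col_cons /= (@mul_block_col _ 1 n 1 n).
  by rewrite mul0mx add0r raddfD/= -mx11_scalar scalar_mxM.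
- exact: measurable_mulmx.
apply: (@scales_integral_skew_fst _ _ _ _ _ lebesgue_measure (lambda n)
  (fun Y (x : measurableTypeR R) => a * x + (v *m Y) ord0 ord0)
  (mulmx S)) => //.
- by move=> Y; exact: scales_lebesgue_affine.
- apply: measurable_funD; first exact: measurable_funM.
  apply: (measurableT_comp (measurable_coord ord0)).
  exact: (measurableT_comp (measurable_mulmx v) measurable_snd).
Qed.

Lemma scales_lebesgue_col_mulmxM (n : nat) (A B : 'M[R]_n) (c e : R) :
  scales_integral (lambda n) (mulmx A) c ->
  scales_integral (lambda n) (mulmx B) e ->
  scales_integral (lambda n) (mulmx (A *m B)) (c * e).
Proof.
move=> HA HB; rewrite (_ : mulmx (A *m B) = mulmx A \o mulmx B).
  exact: scales_integral_comp.
by apply/funext => X; rewrite /= mulmxA.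
Qed.

(* The case of a nonzero corner is a Schur complement; a zero corner is made
   nonzero by adding another row to the first one. *)
Lemma scales_lebesgue_col_mulmx (n : nat) (A : 'M[R]_n) : A \in unitmx ->
  scales_integral (lambda n) (mulmx A) `|\det A|^-1.
Proof.
elim: n A => [|n IH] A Au.
  by rewrite det_mx00 normr1 invr1; exact: scales_lebesgue_col0.
have corner (a : R) (v : 'rV[R]_n) (w : 'cV[R]_n) (S : 'M[R]_n) : a != 0 ->
    let C : 'M[R]_(1 + n) := block_mx (a%:M : 'M[R]_1) v w S in
    C \in unitmx -> scales_integral (lambda n.+1) (mulmx C) `|\det C|^-1.
  move=> a0 C Cu; pose T := S - a^-1 *: w *m v.
  have CE : C = block_mx (1%:M : 'M[R]_1) 0 (a^-1 *: w) 1%:M *m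
                block_mx (a%:M : 'M[R]_1) v 0 T.
    rewrite mulmx_block !mul1mx !mul0mx !addr0.
    by rewrite mul_mx_scalar scalerA mulfV// scale1r /T addrC subrK.
  have detC : \det C = a * \det T.
    by rewrite CE det_mulmx (@det_lblock _ 1 n) (@det_ublock _ 1 n) !det1
      !mul1r det_scalar1.
  have Tu : T \in unitmx.
    by move: Cu; rewrite !unitmxE detC unitrM => /andP[].
  rewrite detC normrM invfM -[_ / _]mul1r CE.
  apply: scales_lebesgue_col_mulmxM; first exact: scales_lebesgue_col_lower.
  by apply: scales_lebesgue_col_upper => //; exact: IH.
have cornerA (C : 'M[R]_(1 + n)) : ulsubmx C ord0 ord0 != 0 ->
    C \in unitmx -> scales_integral (lambda n.+1) (mulmx C) `|\det C|^-1.
  move=> C00.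
  have := corner _ (ursubmx C) (dlsubmx C) (drsubmx C) C00.
  by rewrite -mx11_scalar submxK.
have [A00|] := eqVneq (@ulsubmx _ 1 n 1 n A ord0 ord0) 0; last first.
  by move=> ?; exact: cornerA.
(* Otherwise the whole first column vanishes and [A] is singular. *)
have /existsP[i Ai] : [exists i, @dlsubmx _ 1 n 1 n A i ord0 != 0].
  apply: contraT; rewrite negb_exists => /forallP A0.
  have : \det (A : 'M[R]_(1 + n)) = 0.
    rewrite -(@submxK _ 1 n 1 n A) (_ : dlsubmx _ = 0) ?det_ublock.
      by rewrite [ulsubmx _]mx11_scalar A00 det_scalar1 mul0r.
    apply/colP => i; rewrite [RHS]mxE; apply/eqP.
    by have := A0 i; rewrite negbK.
  by move: Au; rewrite unitmxE unitfE => /eqP.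
pose e : 'rV[R]_n := delta_mx ord0 i.
(* Left multiplication by [E s] adds [s] times row [i] of the lower block to the first row. Thus
   [E 1] puts the nonzero entry found above in the corner, [E (-1)] undoes this, and both have
   determinant 1. *)
pose E (s : R) : 'M[R]_(1 + n) := block_mx (1%:M : 'M[R]_1) (s *: e) 0 1%:M.
have EE : E (-1) *m E 1 = 1%:M.
  rewrite /E mulmx_block !mul1mx !mulmx1 !mul0mx !mulmx0 !add0r !addr0.
  by rewrite scaleN1r scale1r addrN -scalar_mx_block.
have detE s : \det (E s) = 1 by rewrite /E det_ublock !det1 mulr1.
have detEA : \det (E 1 *m (A : 'M[R]_(1 + n))) = \det A.
  by rewrite det_mulmx detE mul1r.
rewrite -[A in mulmx A]mul1mx -EE -mulmxA -detEA.
rewrite -[X in scales_integral _ _ X]mul1r.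
apply: scales_lebesgue_col_mulmxM.
  have := @scales_lebesgue_col_upper n 1 (-1 *: e) 1%:M 1 (oner_neq0 _).
  rewrite normr1 invr1 mulr1; apply.
  rewrite (_ : mulmx 1%:M = id); first exact: scales_integral_id.
  by apply/funext => X; rewrite mul1mx.
apply: cornerA; last by rewrite unitmxE detEA -unitmxE.
rewrite -[A](@submxK _ 1 n 1 n) /E (@mulmx_block _ 1 n 1 n 1 n) block_mxKul.
by rewrite mul1mx scale1r mxE A00 add0r /e -rowE mxE.
Qed.

End lebesgue_linear.

(** * Moving several points by the same map *)

Lemma measurable_map_tuple d (T : measurableType d) (n : nat) (phi : T -> T) :
  measurable_fun setT phi -> measurable_fun setT (@map_tuple n _ _ phi).
Proof.
move=> mphi; apply/measurable_fun_tnthP => i.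
rewrite (_ : _ \o _ = phi \o (tnth (T := T) ^~ i)).
  exact: (measurableT_comp mphi (measurable_tnth i)).
by apply/funext => X; rewrite /= tnth_map.
Qed.

(** Induction on the number of points: the map acts separately on head and tail, and each point
    contributes one factor [c]. *)
Lemma scales_tuple_power d (T : measurableType d) (R : realType)
    (mu : {sigma_finite_measure set T -> \bar R}) (phi : T -> T) (c : R)
    (n : nat) : 0 <= c ->
  scales_integral mu phi c ->
  scales_integral (tuple_power mu n) (@map_tuple n _ _ phi) (c ^+ n).
Proof.
move=> c0 Hphi; elim: n => [|n IH].
  rewrite expr0 (_ : @map_tuple 0 _ _ phi = id).
    exact: scales_integral_id.
  by apply/funext => X; rewrite [LHS]tuple0 [RHS]tuple0.
have mcons : measurable_fun setT
    (fun p : T * n.-tuple T => [tuple of p.1 :: p.2]).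
  exact: measurable_cons.
have mphi : measurable_fun setT (@map_tuple n _ _ phi) by exact: IH.1.
apply: (scales_integral_transfer mcons (@integral_tuple_powerS _ _ _ mu n)
  (phi := fun p : T * n.-tuple T => (phi p.1, map_tuple phi p.2))).
- by move=> p; exact: val_inj.
- exact: measurable_map_tuple Hphi.1.
rewrite exprS.
apply: (@scales_integral_skew_snd _ _ _ _ _ mu (tuple_power mu n)
  phi (fun _ => map_tuple phi)) => //; first exact: exprn_ge0.
exact: (measurableT_comp mphi measurable_snd).
Qed.

(** * Transformation laws of kernels, covariants and normalization *)

Section dual_affine.
Context (R : realType) (M N : nat).
Implicit Types (O : object R M N) (A : 'M[R]_M) (B : 'M[R]_N).

Lemma measurable_domain_power O (L : nat) :
  measurable (dom O) -> measurable (domain_power O L).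
Proof.
move=> mD.
rewrite (_ : domain_power O L = \bigcap_(i in [set: 'I_L])
    ((tnth (T := 'cV[R]_M) ^~ i) @^-1` dom O)).
  apply: fin_bigcap_measurable => // i _.
  by rewrite -[X in measurable X]setTI; exact: measurable_tnth.
by apply/seteqP; split => [X DX i _|X DX i]; exact: DX.
Qed.

(** The image under an invertible [A] is the preimage under its inverse. *)
Lemma measurable_dom_dual_affine O A B : A \in unitmx ->
  measurable (dom O) -> measurable (dom (dual_affine A B O)).
Proof.
move=> Au mD.
rewrite (_ : dom _ = mulmx (invmx A) @^-1` dom O); last first.
  apply/seteqP; split => [_ [X DX <-]|X DX] /=; first by rewrite mulKmx.
  by exists (invmx A *m X) => //; rewrite mulKVmx.
by rewrite -[X in measurable X]setTI; exact: measurable_mulmx.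
Qed.

Lemma preimage_domain_power O A B (L : nat) : A \in unitmx ->
  map_tuple (mulmx A) @^-1` domain_power (dual_affine A B O) L =
  domain_power O L.
Proof.
move=> Au; apply/seteqP; split => X DX i; have := DX i.
  rewrite tnth_map => -[Y DY AY].
  by rewrite -[tnth X i](mulKmx Au) -AY mulKmx.
by move=> DXi; rewrite tnth_map; exists (tnth X i).
Qed.

(** Each primitive is the determinant of a matrix that gets multiplied by [C] on the left; the
    exponents of the resulting factors add up to the order. *)
Lemma eval_kernel_mulmx (n L : nat) (k : moment_kernel n L)
    (V : 'I_L -> 'cV[R]_n) (C : 'M[R]_n) :
  eval_kernel k (fun i => C *m V i) =
  \det C ^+ kernel_order k * eval_kernel k V.
Proof.
rewrite /eval_kernel /kernel_order -prodrXr -big_split/=.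
apply: eq_bigr => p _; rewrite -exprMn; congr (_ ^+ _).
rewrite /primitive -det_mulmx; congr (\det _).
apply/matrixP => i j; rewrite !mxE; apply: eq_bigr => l _.
by rewrite !mxE.
Qed.

Lemma covariant_integrand_dual_affine O A B (L : nat) (kS : moment_kernel M L)
    (kC : moment_kernel N L) (X : L.-tuple 'cV[R]_M) : A \in unitmx ->
  covariant_integrand (dual_affine A B O) kS kC (map_tuple (mulmx A) X) =
  \det A ^+ kernel_order kS * \det B ^+ kernel_order kC *
  covariant_integrand O kS kC X.
Proof.
move=> Au; rewrite /covariant_integrand.
have -> : tnth (map_tuple (mulmx A) X) = fun i => A *m tnth X i.
  by apply/funext => i; rewrite tnth_map.
rewrite /=; under [X in _ * eval_kernel _ X]eq_fun do rewrite mulKmx//.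
by rewrite !eval_kernel_mulmx mulrACA.
Qed.

Lemma covariant_dual_affine O A B (L : nat) (kS : moment_kernel M L)
    (kC : moment_kernel N L) : measurable (dom O) -> A \in unitmx ->
  covariant_finite O kS kC -> covariant_finite (dual_affine A B O) kS kC ->
  covariant (dual_affine A B O) kS kC =
  `|\det A| ^+ L * (\det A ^+ kernel_order kS * \det B ^+ kernel_order kC) *
  covariant O kS kC.
Proof.
move=> mD Au fO fO'; rewrite /covariant.
have dA0 : \det A != 0 by rewrite -unitfE -unitmxE.
have HA : scales_integral (tuple_power (@lebesgue_col R M) L)
    (map_tuple (mulmx A)) (`|\det A|^-1 ^+ L).
  apply: scales_tuple_power; first by rewrite invr_ge0.
  exact: scales_lebesgue_col_mulmx.
have mD' := measurable_domain_power (L := L)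
  (measurable_dom_dual_affine B Au mD).
(* The rule is applied to the integrand of the transformed object, so its covariant appears with the
   factor [|\det A|^-1 ^+ L], which is inverted at the end. *)
have := scales_integral_Rintegral HA mD' fO'.
rewrite preimage_domain_power//.
under eq_Rintegral do rewrite covariant_integrand_dual_affine//.
rewrite RintegralZl//; last exact: measurable_domain_power.
by rewrite -mulrA => ->; rewrite exprVn mulVKf// expf_neq0// normr_eq0.
Qed.

Lemma volume_ge0 O : 0 <= volume O.
Proof.
apply: Rintegral_ge0 => X _.
by rewrite /covariant_integrand /eval_kernel !big_nil mulr1.
Qed.

Lemma square_covariant_ge0 O : 0 <= square_covariant O.
Proof.
apply: Rintegral_ge0 => X _.
rewrite /covariant_integrand /eval_kernel big_nil mul1r big_seq1.
exact: sqr_ge0.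
Qed.

(** The square covariant contributes |det A| to the power N O_C / 2, exactly what is subtracted in
    the exponent of the volume. The exponent of |det B| is 2 times O_C / 2. *)
Lemma normalization_dual_affine O A B (L : nat) (kS : moment_kernel M L)
    (kC : moment_kernel N L) : measurable (dom O) -> A \in unitmx ->
  @covariant_finite _ _ _ O 1 [::] [::] ->
  @covariant_finite _ _ _ (dual_affine A B O) 1 [::] [::] ->
  @covariant_finite _ _ _ O N [::] (@square_kernel N) ->
  @covariant_finite _ _ _ (dual_affine A B O) N [::] (@square_kernel N) ->
  normalization (dual_affine A B O) kS kC =
  `|\det A| ^+ (kernel_order kS + L) * `|\det B| ^+ kernel_order kC *
  normalization O kS kC.
Proof.
move=> mD Au fv fv' fs fs'.
have dA0 : `|\det A| != 0 by rewrite normr_eq0 -unitfE -unitmxE.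
have vE : volume (dual_affine A B O) = `|\det A| * volume O.
  rewrite /volume covariant_dual_affine// /kernel_order !big_nil.
  by rewrite !expr0 !mulr1.
have sE : square_covariant (dual_affine A B O) =
    `|\det A| ^+ N * `|\det B| ^+ 2 * square_covariant O.
  rewrite /square_covariant covariant_dual_affine// /kernel_order big_nil.
  by rewrite /square_kernel big_seq1 expr0 mul1r real_normK ?num_real.
rewrite /normalization vE sE.
set e := (kernel_order kC)%:R / 2.
(* Real powers distribute over products of nonnegative bases, whence absolute values of determinants
   throughout. *)
rewrite powRM ?volume_ge0// powRM ?square_covariant_ge0 ?mulr_ge0 ?exprn_ge0//.
rewrite powRM ?exprn_ge0// -!powR_mulrn// -!powRrM.
rewrite (_ : 2%:R * e = (kernel_order kC)%:R); last by rewrite /e mulrC divfK.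
set f := _ - _.
have -> : (kernel_order kS + L)%:R = f + N%:R * e.
  by rewrite /f /e natrM mulrA subrK.
(* If the exponents sum to zero, this law requires a nonzero base, which invertibility of [A]
   provides. *)
have powD (g h : R) : `|\det A| `^ (g + h) = `|\det A| `^ g * `|\det A| `^ h.
  by rewrite powRD// dA0 implybT.
by rewrite (powD f) mulrACA !mulrA.
Qed.

End dual_affine.

(* A negative determinant raised to an odd order leaves a sign that the
   normalization, built from |det A| and |det B|, does not cancel. *)
Theorem mainTheorem1 (R : realType) (M N L : nat)
    (M_gt0 : (0 < M)%N) (N_gt0 : (0 < N)%N)
    (O : object R M N) (measD : measurable (dom O))
    (A : 'M[R]_M) (A_inv : A \in unitmx) (B : 'M[R]_N)
    (kS : moment_kernel M L) (kC : moment_kernel N L)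
    (kS_ok : is_moment_kernel kS) (kC_ok : is_moment_kernel kC)
    (cover : (point_set kS :|: point_set kC = [set: 'I_L])%SET)
    (defO : moment_invariant_defined O kS kC)
    (defO' : moment_invariant_defined (dual_affine A B O) kS kC) :
  (0 < \det A ^+ kernel_order kS * \det B ^+ kernel_order kC ->
     moment_invariant (dual_affine A B O) kS kC = moment_invariant O kS kC) /\
  moment_invariant (dual_affine A B O) kS kC =
    Num.sg (\det A) ^+ kernel_order kS * Num.sg (\det B) ^+ kernel_order kC *
    moment_invariant O kS kC.
Proof.
have [fc fv fs n0] := defO; have [fc' fv' fs' n0'] := defO'.
suff E : moment_invariant (dual_affine A B O) kS kC =
    Num.sg (\det A) ^+ kernel_order kS * Num.sg (\det B) ^+ kernel_order kC *
    moment_invariant O kS kC.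
  split; last exact: E.
  by move=> /gtr0_sg; rewrite sgrM !sgrX E => ->; exact: mul1r.
have nE := normalization_dual_affine kS kC measD A_inv fv fv' fs fs'.
have dABE : \det A ^+ kernel_order kS * \det B ^+ kernel_order kC =
    Num.sg (\det A) ^+ kernel_order kS * Num.sg (\det B) ^+ kernel_order kC *
    (`|\det A| ^+ kernel_order kS * `|\det B| ^+ kernel_order kC).
  by rewrite {1}[\det A]numEsg {1}[\det B]numEsg !exprMn mulrACA.
rewrite /moment_invariant nE covariant_dual_affine// dABE.
(* [B] may be singular; the nonzero transformed normalization is what makes the common factor of
   absolute values cancellable. *)
move: n0'; rewrite nE mulf_eq0 negb_or => /andP[k0 _].
set k := (X in X != 0) in k0 *; set s := Num.sg _ ^+ _ * _.
rewrite (_ : _ ^+ L * (s * _) = k * s); last first.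
  rewrite mulrCA [LHS]mulrC; congr (_ * s).
  by rewrite /k exprD mulrA [_ ^+ L * _]mulrC.
by rewrite -[X in X / _]mulrA invfM mulrACA mulfV// mul1r mulrA.
Qed.
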